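(* Let $R$ be a real closed field equipped with an o-minimal structure expanding $R$. Let $X\subset R^n$ be a locally closed definable set. Let $\phi_1,\phi_2:X\to R$ be non-negative continuous definable functions satisfying $\phi_2^{-1}(0)\subset\phi_1^{-1}(0)$. Then there exist a strictly increasing continuous definable function $\rho:[0,+\infty)\to[0,+\infty)$ (where $[0,+\infty)\subset R$) and a positive continuous definable function $c:X\to R$ such that $c|_{\phi_2^{-1}(0)}=1$ and $$\forall x\in X,\quad \phi_2(x)\ge c(x)\,\rho(\phi_1(x)).$$
   Context: An o-minimal structure expanding a real closed field $R$ is a collection $(\mathcal S^n)_{n\in\mathbb N}$, $\mathcal S^n$ a Boolean algebra of subsets of $R^n$ containing all algebraic subsets, closed under Cartesian products and under the projections $R^{n+1}\to R^n$ onto the first $n$ coordinates, and such that elements of $\mathcal S^1$ are finite unions of points and open intervals with endpoints in $R\cup\{\pm\infty\}$. Members of the collection are called definable sets; a function between definable sets is definable if its graph is definable. All topological notions refer to the Euclidean (order) topology of $R$. *)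

(* Defs.v *)
From mathcomp Require Import all_boot all_order all_algebra.
From mathcomp Require Import classical_sets constructive_ereal topology normedtype.
(* The notations of mpoly clash with those of the analysis library. *)
From mathcomp Require Import -(notations) mpoly.

Set Implicit Arguments.
Unset Strict Implicit.
Unset Printing Implicit Defensive.

Import Order.TTheory GRing.Theory Num.Theory.
Import numFieldNormedType.Exports.

Local Open Scope classical_set_scope.
Local Open Scope ring_scope.

(* R^n is 'rV[R]_n.  The library topology on R and on 'rV[R]_n is generated by
   the balls |x - y| < e with e : R, i.e. it is the Euclidean (order) topology,
   for every real closed field R. *)

Definition algebraic_set (R : rcfType) (n : nat) (A : set 'rV[R]_n) : Prop :=
  exists ps : seq (mpoly n R),
    A = [set x | forall p, p \in ps -> meval (fun i => x 0 i) p = 0].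

Definition prod_set (R : rcfType) (m n : nat)
    (A : set 'rV[R]_m) (B : set 'rV[R]_n) : set 'rV[R]_(m + n) :=
  [set z | A (lsubmx z) /\ B (rsubmx z)].

Definition finite_union_points_intervals (R : rcfType) (A : set 'rV[R]_1) : Prop :=
  exists (pts : seq R) (itvs : seq (\bar R * \bar R)),
    A = [set x | x 0 0 \in pts \/
                 exists2 ab, ab \in itvs & (ab.1 < (x 0 0)%:E < ab.2)%E].

Record ominimal_structure (R : rcfType) := OMinimalStructure {
  definable : forall n, set (set 'rV[R]_n);
  definable0 : forall n, definable (@set0 'rV[R]_n);
  definableU : forall n (A B : set 'rV[R]_n),
    definable A -> definable B -> definable (A `|` B);
  definableC : forall n (A : set 'rV[R]_n), definable A -> definable (~` A);
  definable_algebraic : forall n (A : set 'rV[R]_n),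
    algebraic_set A -> definable A;
  definable_prod : forall m n (A : set 'rV[R]_m) (B : set 'rV[R]_n),
    definable A -> definable B -> definable (prod_set A B);
  definable_proj : forall n (A : set 'rV[R]_(n + 1)),
    definable A -> definable [set lsubmx z | z in A];
  definable_ominimal : forall A : set 'rV[R]_1,
    definable A -> finite_union_points_intervals A }.

(* A function A -> R, with A a subset of R^n, is represented by a total function
   of which only the values on A matter. *)
Definition graph_on (R : rcfType) (n : nat) (A : set 'rV[R]_n)
    (f : 'rV[R]_n -> R) : set 'rV[R]_(n + 1) :=
  [set z | A (lsubmx z) /\ rsubmx z 0 0 = f (lsubmx z)].

Definition definable_fun (R : rcfType) (S : ominimal_structure R) (n : nat)
    (A : set 'rV[R]_n) (f : 'rV[R]_n -> R) : Prop :=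
  definable S A /\ definable S (graph_on A f).

Definition locally_closed (T : topologicalType) (A : set T) : Prop :=
  exists U F : set T, [/\ open U, closed F & A = U `&` F].

Definition nonneg_ray (R : rcfType) : set R := [set t | 0 <= t].
Arguments nonneg_ray : clear implicits.

(* Main.v *)
Require Import Defs.
From mathcomp Require Import all_boot all_order all_algebra.
From mathcomp Require Import boolp classical_sets constructive_ereal topology normedtype.
From mathcomp Require Import -(notations) mpoly.
From mathcomp Require Import lra.
Import Order.TTheory GRing.Theory Num.Theory.
Import numFieldNormedType.Exports.
Local Open Scope classical_set_scope.
Local Open Scope ring_scope.
(** Let d be the distance to cl X \ X, truncated at 1. It is positive on X since X
    is open in its closure, and with h x = d x / (1 + sum x_i^2) the superlevel sets
    {x in X | s <= h x} are closed and bounded. Put sq t = t / (1 + |t|) and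
    w = min (h, sq o phi1). The inf-convolution
      nu s = inf ({max (0, s)} u {phi2 x + max (0, s - w x) | x in X})
    is definable, nondecreasing and 1-Lipschitz, and nu (w x) <= phi2 x on X. It is
    positive for s > 0: otherwise points of X with phi2 -> 0, h >= s / 2 and
    sq o phi1 >= s / 2 would cluster, by a definable Bolzano-Weierstrass argument, at a
    zero of phi2 in X at which phi1 > 0. As nu, h, sq have values in [0, 1],
      phi2 >= nu (min (h, sq o phi1)) >= nu h * q with q = (nu o sq * sq) o phi1,
    so rho = (nu o sq * sq)^2 and c = nu h / (nu h + q) satisfy c * rho o phi1 <= phi2,
    and c = 1 wherever phi1 = 0. No cell decomposition is used: o-minimality only
    enters through the existence of infima of definable subsets of R. *)

Set Implicit Arguments.
Unset Strict Implicit.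
Unset Printing Implicit Defensive.

(** * Definable sets and functions *)

Section Definability.
Variables (R : rcfType) (S : ominimal_structure R).

(* Definability of a subset given as a predicate, so that the closure lemmas below can
   be applied following the syntax of a first-order formula. *)
Definition Dset n (P : 'rV[R]_n -> Prop) : Prop := definable S P.

(** Functions are taken total, so that terms compose without domain conditions; a function on [X]
    enters through its extension by 0, see [Dfun_extend]. *)
Definition Dfun n (f : 'rV[R]_n -> R) : Prop :=
  Dset (fun z : 'rV[R]_(n + 1) => rsubmx z 0 0 = f (lsubmx z)).

Definition Dvec n m (F : 'rV[R]_n -> 'rV[R]_m) : Prop :=
  forall i, Dfun (fun x => F x 0 i).

Lemma Dset_ext n (P Q : 'rV[R]_n -> Prop) :
  (forall x, P x <-> Q x) -> Dset P -> Dset Q.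
Proof. by move=> PQ; have -> : P = Q by apply/funext => x; apply/propext. Qed.

Lemma Dset_or n (P Q : 'rV[R]_n -> Prop) :
  Dset P -> Dset Q -> Dset (fun x => P x \/ Q x).
Proof. exact: definableU. Qed.

Lemma Dset_not n (P : 'rV[R]_n -> Prop) : Dset P -> Dset (fun x => ~ P x).
Proof. exact: definableC. Qed.

Lemma Dset_and n (P Q : 'rV[R]_n -> Prop) :
  Dset P -> Dset Q -> Dset (fun x => P x /\ Q x).
Proof.
move=> dP dQ; apply: Dset_ext (Dset_not (Dset_or (Dset_not dP) (Dset_not dQ))).
by move=> x; rewrite not_orE !notE.
Qed.

Lemma Dset_imp n (P Q : 'rV[R]_n -> Prop) :
  Dset P -> Dset Q -> Dset (fun x => P x -> Q x).
Proof.
move=> dP dQ; apply: Dset_ext (Dset_or (Dset_not dP) dQ) => x.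
by rewrite implyE.
Qed.

Lemma Dset_const n (P : Prop) : Dset (fun _ : 'rV[R]_n => P).
Proof.
have [p|np] := pselect P; last first.
  by apply: Dset_ext (definable0 S n) => x; split=> // /np.
by apply: Dset_ext (definableC (definable0 S n)) => x; split=> // _ [].
Qed.

Lemma Dset_fall n (I : finType) (P : I -> 'rV[R]_n -> Prop) :
  (forall i, Dset (P i)) -> Dset (fun x => forall i, P i x).
Proof.
move=> dP.
suff h (s : seq I) : Dset (fun x => forall i, i \in s -> P i x).
  by apply: Dset_ext (h (enum I)) => x; split=> H i *; apply: H; rewrite ?mem_enum.
elim: s => [|i s IH]; first by apply: Dset_ext (Dset_const n True).
apply: Dset_ext (Dset_and (dP i) IH) => x; split=> [[Pi Ps] j|H].
  by rewrite inE => /predU1P[->|/Ps].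
by split=> [|j js]; apply: H; rewrite inE ?eqxx ?js ?orbT.
Qed.

Lemma Dset_poly n (p q : mpoly n R) :
  Dset (fun x : 'rV[R]_n => meval (fun i => x 0 i) p = meval (fun i => x 0 i) q).
Proof.
apply: (@definable_algebraic _ S); exists [:: p - q].
apply/funext => x; apply/propext; split => [e r|/(_ _ (mem_head _ _))].
  by rewrite inE => /eqP ->; rewrite mevalB e subrr.
by rewrite mevalB => /eqP; rewrite subr_eq0 => /eqP.
Qed.

(** Iterates the one-coordinate projection [k] times. Stating [N = n + k] as an equation and
    matching indices through their values in [nat] avoids casts between row vector types. *)
Lemma Dset_proj n k N (A : 'rV[R]_N -> Prop) : N = (n + k)%N -> Dset A ->
  Dset (fun x : 'rV[R]_n => exists z, A z /\
    forall (i : 'I_n) (j : 'I_N), i = j :> nat -> z 0 j = x 0 i).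
Proof.
elim: k N A => [|k IH] N A.
  rewrite addn0 => e; subst N; apply: Dset_ext => x; split=> [Ax|[z [Az zx]]].
    by exists x; split=> // i j ij; congr (x 0 _); apply/val_inj.
  by have <- : z = x by apply/rowP => i; apply: zx.
rewrite -addn1 addnA => e; subst N => dA.
apply: Dset_ext (IH _ _ erefl (definable_proj dA)) => x; split.
  move=> [_ [[z Az <-] zx]]; exists z; split=> // i j ij.
  have jlt : (j < n + k)%N by rewrite -ij (leq_trans (ltn_ord i)) ?leq_addr.
  by rewrite -(zx i (Ordinal jlt) ij) mxE; congr (z 0 _); apply/val_inj.
move=> [z [Az zx]]; exists (lsubmx z); split; first by exists z.
by move=> i j ij; rewrite mxE; apply: zx.
Qed.

Lemma Dset_exv n m (P : 'rV[R]_n -> 'rV[R]_m -> Prop) :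
  Dset (fun z : 'rV[R]_(n + m) => P (lsubmx z) (rsubmx z)) ->
  Dset (fun x => exists y, P x y).
Proof.
move=> /(Dset_proj erefl); apply: Dset_ext => x; split=> [[z [Pz zx]]|[y Py]].
  have <- : lsubmx z = x by apply/rowP => i; rewrite mxE; apply: zx.
  by exists (rsubmx z).
exists (row_mx x y); split; first by rewrite row_mxKl row_mxKr.
by move=> i j ij; have -> : j = lshift m i; [apply/val_inj | rewrite row_mxEl].
Qed.

Lemma Dset_ex n (P : 'rV[R]_n -> R -> Prop) :
  Dset (fun z : 'rV[R]_(n + 1) => P (lsubmx z) (rsubmx z 0 0)) ->
  Dset (fun x => exists t, P x t).
Proof.
move=> dP; apply: Dset_ext (Dset_exv (P := fun x y => P x (y 0 0)) dP) => x.
by split=> [[y Py]|[t Pt]]; [exists (y 0 0) | exists t%:M; rewrite mxE].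
Qed.

Lemma Dset_all n (P : 'rV[R]_n -> R -> Prop) :
  Dset (fun z : 'rV[R]_(n + 1) => P (lsubmx z) (rsubmx z 0 0)) ->
  Dset (fun x => forall t, P x t).
Proof.
move=> dP; apply: Dset_ext (Dset_not (Dset_ex (P := fun x t => ~ P x t) (Dset_not dP))).
by move=> x; rewrite -forallNE; split=> H t; [apply: contrapT|have := H t; tauto].
Qed.

(** * Substitution and composition of definable maps *)

Lemma Dset_coord n (i j : 'I_n) : Dset (fun x : 'rV[R]_n => x 0 i = x 0 j).
Proof.
by apply: Dset_ext (Dset_poly (mpolyX R (mnm1 i)) (mpolyX R (mnm1 j))) => x; rewrite !mevalXU.
Qed.

(** The set is the projection to [x] of the pairs [(x, y)] with [y] in [A] and [y i = x (s i)], a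
    product cut by algebraic equations. No condition on [s] is needed, so variables may be dropped,
    repeated or permuted. *)
Lemma Dset_reindex n m (A : 'rV[R]_m -> Prop) (s : 'I_m -> 'I_n) :
  Dset A -> Dset (fun x : 'rV[R]_n => A (\row_i x 0 (s i))).
Proof.
move=> dA.
suff : Dset (fun x : 'rV[R]_n =>
    exists y : 'rV[R]_m, (forall i, y 0 i = x 0 (s i)) /\ A y).
  apply: Dset_ext => x; split=> [[y [yx Ay]]|Ax].
    by have <- : y = \row_i x 0 (s i) by apply/rowP => i; rewrite mxE.
  by exists (\row_i x 0 (s i)); split=> // i; rewrite mxE.
apply: Dset_exv; apply: Dset_and.
  apply: Dset_fall => i; apply: Dset_ext (Dset_coord (rshift n i) (lshift m (s i))) => z.
  by rewrite !mxE.
by apply: Dset_ext (definable_prod (Dset_const n True) dA) => z; split=> [[]|].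
Qed.

Lemma Dfun_coord n (i : 'I_n) : Dfun (fun x => x 0 i).
Proof.
by apply: Dset_ext (Dset_coord (rshift n ord0) (lshift 1 i)) => z; rewrite !mxE.
Qed.

Lemma Dset_comp n m (A : 'rV[R]_m -> Prop) (F : 'rV[R]_n -> 'rV[R]_m) :
  Dset A -> Dvec F -> Dset (fun x => A (F x)).
Proof.
move=> dA dF.
suff : Dset (fun x => exists y : 'rV[R]_m, (forall i, y 0 i = F x 0 i) /\ A y).
  apply: Dset_ext => x; split=> [[y [yx Ay]]|Ax]; last by exists (F x).
  by have <- : y = F x by apply/rowP.
apply: Dset_exv; apply: Dset_and.
  apply: Dset_fall => i.
  (* Reads [(x, y i)] off [(x, y)], which turns the graph of the [i]-th component of [F] into a
     condition on pairs. *)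
  pose s (j : 'I_(n + 1)) : 'I_(n + m) :=
    if split j is inl k then lshift m k else rshift n i.
  apply: Dset_ext (Dset_reindex s (dF i)) => z; rewrite !mxE /s.
  rewrite (unsplitK (inr _ : 'I_n + 'I_1)).
  suff -> : lsubmx (\row_j z 0 (s j)) = lsubmx z by [].
  by apply/rowP => j; rewrite !mxE /s (unsplitK (inl _ : 'I_n + 'I_1)).
apply: Dset_ext (Dset_reindex (fun i => rshift n i) dA) => z.
by suff -> : \row_i z 0 (rshift n i) = rsubmx z by []; apply/rowP => i; rewrite !mxE.
Qed.

Lemma Dvec_id n : Dvec (fun x : 'rV[R]_n => x).
Proof. by move=> i; apply: Dfun_coord. Qed.

Lemma Dfun_app n m (F : 'rV[R]_n -> 'rV[R]_m) i :
  Dvec F -> Dfun (fun x => F x 0 i).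
Proof. exact. Qed.

Lemma Dvec_lsub n m k (F : 'rV[R]_n -> 'rV[R]_(m + k)) :
  Dvec F -> Dvec (fun x => lsubmx (F x)).
Proof.
by move=> dF i; apply: Dset_ext (dF (lshift k i)) => z; rewrite [lsubmx (F _) _ _]mxE.
Qed.

Lemma Dvec_rsub n m k (F : 'rV[R]_n -> 'rV[R]_(m + k)) :
  Dvec F -> Dvec (fun x => rsubmx (F x)).
Proof.
by move=> dF i; apply: Dset_ext (dF (rshift m i)) => z; rewrite [rsubmx (F _) _ _]mxE.
Qed.

Lemma Dvec_row n m k (F : 'rV[R]_n -> 'rV[R]_m) (G : 'rV[R]_n -> 'rV[R]_k) :
  Dvec F -> Dvec G -> Dvec (fun x => row_mx (F x) (G x)).
Proof.
move=> dF dG i; case: (split_ordP i) => j ->.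
  by apply: Dset_ext (dF j) => z; rewrite row_mxEl.
by apply: Dset_ext (dG j) => z; rewrite row_mxEr.
Qed.

Lemma Dvec_scalar n (f : 'rV[R]_n -> R) : Dfun f -> Dvec (fun x => (f x)%:M : 'rV[R]_1).
Proof. by move=> df i; rewrite ord1; apply: Dset_ext df => z; rewrite [_%:M _ _]mxE. Qed.

(** The graph of the composite is the preimage of the graph of [g] under [(x, t) |-> (F x, t)]. *)
Lemma Dfun_comp n m (g : 'rV[R]_m -> R) (F : 'rV[R]_n -> 'rV[R]_m) :
  Dfun g -> Dvec F -> Dfun (fun x => g (F x)).
Proof.
move=> dg dF.
have dFl : Dvec (fun z : 'rV[R]_(n + 1) => F (lsubmx z)).
  (* Here [s] drops the middle entry of [(x, t, u)], since [F] ignores the extra variable [t]. *)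
  move=> i; pose s (j : 'I_(n + 1)) : 'I_(n + 1 + 1) :=
    if split j is inl k then lshift 1 (lshift 1 k) else rshift (n + 1) ord0.
  apply: Dset_ext (Dset_reindex s (dF i)) => z; rewrite !mxE /s.
  rewrite (unsplitK (inr _ : 'I_n + 'I_1)).
  suff -> : lsubmx (\row_j z 0 (s j)) = lsubmx (lsubmx z) by [].
  by apply/rowP => j; rewrite !mxE /s (unsplitK (inl _ : 'I_n + 'I_1)).
apply: Dset_ext (Dset_comp dg (Dvec_row dFl (Dvec_rsub (@Dvec_id _)))) => z.
by rewrite row_mxKl row_mxKr.
Qed.

Lemma Dfun_comp1 n (g : R -> R) (f : 'rV[R]_n -> R) :
  Dfun (fun x : 'rV[R]_1 => g (x 0 0)) -> Dfun f -> Dfun (fun x => g (f x)).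
Proof.
by move=> dg df; apply: Dset_ext (Dfun_comp dg (Dvec_scalar df)) => z; rewrite [_%:M _ _]mxE.
Qed.

Lemma Dset_bin n (A : R -> R -> Prop) (f g : 'rV[R]_n -> R) :
  Dset (fun x : 'rV[R]_(1 + 1) => A (x 0 ord0) (x 0 ord_max)) ->
  Dfun f -> Dfun g -> Dset (fun x => A (f x) (g x)).
Proof.
move=> dA df dg; apply: Dset_ext (Dset_comp dA (Dvec_row (Dvec_scalar df) (Dvec_scalar dg))).
move=> x; have -> : ord_max = rshift 1 ord0 :> 'I_(1 + 1) by apply/val_inj.
have -> : ord0 = lshift 1 ord0 :> 'I_(1 + 1) by apply/val_inj.
by rewrite row_mxEl row_mxEr !mxE.
Qed.

Lemma Dfun_bin n (h : R -> R -> R) (f g : 'rV[R]_n -> R) :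
  Dfun (fun x : 'rV[R]_(1 + 1) => h (x 0 ord0) (x 0 ord_max)) ->
  Dfun f -> Dfun g -> Dfun (fun x => h (f x) (g x)).
Proof.
move=> dA df dg; apply: Dset_ext (Dfun_comp dA (Dvec_row (Dvec_scalar df) (Dvec_scalar dg))).
move=> x; have -> : ord_max = rshift 1 ord0 :> 'I_(1 + 1) by apply/val_inj.
have -> : ord0 = lshift 1 ord0 :> 'I_(1 + 1) by apply/val_inj.
by rewrite row_mxEl row_mxEr !mxE.
Qed.

(** * Polynomial arithmetic, order and automation *)

Lemma Dset_eq n (f g : 'rV[R]_n -> R) :
  Dfun f -> Dfun g -> Dset (fun x => f x = g x).
Proof. by apply: (Dset_bin (A := eq)); apply: Dset_coord. Qed.

Lemma Dfun_poly n (p : mpoly n R) : Dfun (fun x => meval (fun i => x 0 i) p).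
Proof.
(* [q] is [p] with its variables renamed to the first [n] of [n + 1], so that the graph of [p]
   becomes a polynomial equation. *)
pose q : mpoly (n + 1) R := mmap (mpolyC (n + 1) (R := R))
  (fun i => mpolyX R (mnm1 (lshift 1 i))) p.
apply: Dset_ext (Dset_poly (mpolyX R (mnm1 (rshift n ord0))) q) => z.
rewrite mevalXU [rsubmx _ _ _]mxE.
suff -> : meval (fun i => z 0 i) q = meval (fun i => lsubmx z 0 i) p by [].
rewrite /q /mmap raddf_sum mevalE; apply: eq_bigr => m _ /=.
rewrite mevalM mevalC /mmap1 rmorph_prod; congr (_ * _); apply: eq_bigr => i _.
by rewrite rmorphXn /= mevalXU mxE.
Qed.

Lemma Dfun_add n (f g : 'rV[R]_n -> R) :
  Dfun f -> Dfun g -> Dfun (fun x => f x + g x).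
Proof.
apply: (Dfun_bin (h := fun s t => s + t)).
apply: Dset_ext (Dfun_poly (mpolyX R (mnm1 ord0) + mpolyX R (mnm1 ord_max))) => z.
by rewrite mevalD !mevalXU.
Qed.

Lemma Dfun_mul n (f g : 'rV[R]_n -> R) :
  Dfun f -> Dfun g -> Dfun (fun x => f x * g x).
Proof.
apply: (Dfun_bin (h := fun s t => s * t)).
apply: Dset_ext (Dfun_poly (mpolyX R (mnm1 ord0) * mpolyX R (mnm1 ord_max))) => z.
by rewrite mevalM !mevalXU.
Qed.

Lemma Dfun_const n (c : R) : Dfun (fun _ : 'rV[R]_n => c).
Proof. by apply: Dset_ext (Dfun_poly (mpolyC n c)) => z; rewrite mevalC. Qed.

Lemma Dfun_opp n (f : 'rV[R]_n -> R) : Dfun f -> Dfun (fun x => - f x).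
Proof.
by move=> df; apply: Dset_ext (Dfun_mul (Dfun_const n (- 1)) df) => z; rewrite mulN1r.
Qed.

(** In a real closed field the nonnegative elements are the squares, so the order is the projection
    of an algebraic set. *)
Lemma Dset_le n (f g : 'rV[R]_n -> R) :
  Dfun f -> Dfun g -> Dset (fun x => f x <= g x).
Proof.
apply: (Dset_bin (A := fun s t => s <= t)).
suff : Dset (fun x : 'rV[R]_(1 + 1) => exists t, x 0 ord_max = x 0 ord0 + t * t).
  apply: Dset_ext => x; split=> [[t ->]|le]; first by rewrite lerDl -expr2 sqr_ge0.
  exists (Num.sqrt (x 0 ord_max - x 0 ord0)).
  by rewrite -expr2 sqr_sqrtr ?subr_ge0 // addrC subrK.
by apply: Dset_ex; apply: Dset_eq; [|apply: Dfun_add; [|apply: Dfun_mul]];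
  do ?[apply: Dfun_app]; do ?[apply: Dvec_rsub]; do ?[apply: Dvec_lsub]; apply: Dvec_id.
Qed.

Lemma Dset_lt n (f g : 'rV[R]_n -> R) :
  Dfun f -> Dfun g -> Dset (fun x => f x < g x).
Proof.
move=> df dg; apply: Dset_ext (Dset_not (Dset_le dg df)) => x.
by rewrite ltNge; split=> [/negP|/negP].
Qed.

Lemma Dfun_graph n (G : 'rV[R]_n -> R -> Prop) (f : 'rV[R]_n -> R) :
  (forall x t, G x t <-> t = f x) ->
  Dset (fun z : 'rV[R]_(n + 1) => G (lsubmx z) (rsubmx z 0 0)) -> Dfun f.
Proof. by move=> Gf; apply: Dset_ext => z; apply: Gf. Qed.

Lemma Dfun_sum n (I : finType) (f : I -> 'rV[R]_n -> R) :
  (forall i, Dfun (f i)) -> Dfun (fun x => \sum_i f i x).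
Proof.
move=> df; suff h (s : seq I) : Dfun (fun x => \sum_(i <- s) f i x).
  by apply: Dset_ext (h (index_enum I)).
elim: s => [|i s IH].
  by apply: Dset_ext (Dfun_const n 0) => z; rewrite big_nil.
by apply: Dset_ext (Dfun_add (df i) IH) => z; rewrite big_cons.
Qed.

Lemma Dset_rel n m (E : 'rV[R]_m -> R -> Prop) (F : 'rV[R]_n -> 'rV[R]_m) f :
  Dset (fun z : 'rV[R]_(m + 1) => E (lsubmx z) (rsubmx z 0 0)) ->
  Dvec F -> Dfun f -> Dset (fun x => E (F x) (f x)).
Proof.
move=> dE dF df; apply: Dset_ext (Dset_comp dE (Dvec_row dF (Dvec_scalar df))) => x.
by rewrite row_mxKl row_mxKr mxE.
Qed.

(* Redefined below, once the functions that it handles are known to be definable. *)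
Ltac definable_ext := fail.

(** Each case peels one symbol off a formula, term or tuple. Definable sets and functions of the
    context are composed with their arguments; what remains goes to [definable_ext] or is tried as a
    constant. *)
Ltac definable :=
  cbv beta;
  lazymatch goal with
  | |- Dset (fun x => @?P x /\ @?Q x) => apply: (Dset_and (P := P) (Q := Q)); definable
  | |- Dset (fun x => @?P x \/ @?Q x) => apply: (Dset_or (P := P) (Q := Q)); definable
  | |- Dset (fun x => ~ @?P x) => apply: (Dset_not (P := P)); definable
  | |- Dset (fun x => @?P x -> @?Q x) => apply: (Dset_imp (P := P) (Q := Q)); definable
  | |- Dset (fun x => exists t, @?P x t) =>
      first [apply: (Dset_ex (P := P)) | apply: (Dset_exv (P := P))]; definable
  | |- Dset (fun x => forall t, @?P x t) =>
      first [apply: (Dset_all (P := P))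
            | apply: Dset_fall; let i := fresh "i" in move=> i];
      definable
  | |- Dset (fun x => @?f x = @?g x) => apply: (Dset_eq (f := f) (g := g)); definable
  | |- Dset (fun x => is_true (@?f x <= @?g x)) => apply: (Dset_le (f := f) (g := g)); definable
  | |- Dset (fun x => is_true (@?f x < @?g x)) => apply: (Dset_lt (f := f) (g := g)); definable
  | H : Dset ?A |- Dset (fun x => ?A (@?F x)) => apply: (Dset_comp (F := F) H); definable
  | H : Dset (fun z => ?E (@lsubmx _ _ _ _ z) (@fun_of_matrix _ _ _ (@rsubmx _ _ _ _ z) _ _))
    |- Dset (fun x => ?E (@?F x) (@?f x)) =>
      apply: (Dset_rel (F := F) (f := f) H); definable
  | H : Dfun ?f |- Dfun (fun x => ?f (@?F x)) => apply: (Dfun_comp (F := F) H); definable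
  | |- Dfun (fun x => \sum_i @?f x i) =>
      apply: Dfun_sum; let i := fresh "i" in move=> i; definable
  | |- Dfun (fun x => @?f x + @?g x) => apply: (Dfun_add (f := f) (g := g)); definable
  | |- Dfun (fun x => - @?f x) => apply: (Dfun_opp (f := f)); definable
  | |- Dfun (fun x => @?f x * @?g x) => apply: (Dfun_mul (f := f) (g := g)); definable
  | |- Dfun (fun x => @fun_of_matrix _ _ _ (@?F x) _ ?i) => apply: (Dfun_app (F := F) i); definable
  | |- Dvec (fun x => x) => apply: Dvec_id
  | |- Dvec (fun x => lsubmx (@?F x)) => apply: (Dvec_lsub (F := F)); definable
  | |- Dvec (fun x => rsubmx (@?F x)) => apply: (Dvec_rsub (F := F)); definable
  | |- Dvec (fun x => @row_mx _ _ _ _ (@?F x) (@?G x)) => apply: (Dvec_row (F := F) (G := G)); definable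
  | |- Dvec (fun x => (@?f x)%:M) => apply: (Dvec_scalar (f := f)); definable
  | |- Dset _ => try apply: Dset_const
  | |- Dfun _ => first [definable_ext; definable | try apply: Dfun_const]
  | |- Dvec _ => try (let i := fresh "i" in move=> i; apply: Dfun_const)
  end.

Lemma Dfun_if n (P : 'rV[R]_n -> Prop) (f g : 'rV[R]_n -> R) :
  Dset P -> Dfun f -> Dfun g -> Dfun (fun x => if pselect (P x) then f x else g x).
Proof.
move=> dP df dg.
apply: (Dfun_graph (G := fun x t => (P x /\ t = f x) \/ (~ P x /\ t = g x))); last by definable.
by move=> x t; case: pselect => Px; split=> [[[]|[]]|]; [| |left| | |right].
Qed.

Lemma Dfun_inv n (f : 'rV[R]_n -> R) : Dfun f -> Dfun (fun x => (f x)^-1).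
Proof.
move=> df.
(* The first disjunct accounts for the convention [0^-1 = 0]. *)
apply: (Dfun_graph (G := fun x t => (f x = 0 /\ t = 0) \/ f x * t = 1)); last by definable.
move=> x t; split=> [[[-> ->]|fxt1]|->]; first by rewrite invr0.
  have fx0 : f x != 0 by apply: contra_eq_neq fxt1 => ->; rewrite mul0r eq_sym oner_eq0.
  by rewrite -[RHS]mulr1 -fxt1 mulKf.
by have [->|/mulfV] := eqVneq (f x) 0; [left; rewrite invr0|right].
Qed.

Lemma Dfun_min n (f g : 'rV[R]_n -> R) :
  Dfun f -> Dfun g -> Dfun (fun x => Num.min (f x) (g x)).
Proof.
move=> df dg; apply: Dset_ext (Dfun_if (Dset_lt df dg) df dg) => z.
by rewrite minEle; case: pselect; case: ltgtP => // -> .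
Qed.

Lemma Dfun_norm n (f : 'rV[R]_n -> R) : Dfun f -> Dfun (fun x => `|f x|).
Proof.
move=> df; apply: Dset_ext (Dfun_if (Dset_le (Dfun_const n 0) df) df (Dfun_opp df)) => z.
case: pselect => z0 /=; first by rewrite (ger0_norm z0).
by move/negP: z0; rewrite -ltNge => z0; rewrite (ltr0_norm z0).
Qed.

(** * Infima of definable families *)

Definition is_glb (A : R -> Prop) (a : R) : Prop :=
  (forall x, A x -> a <= x) /\ (forall b, (forall x, A x -> b <= x) -> b <= a).

Lemma is_glb_unique A a b : is_glb A a -> is_glb A b -> a = b.
Proof.
by move=> [al ag] [bl bg]; apply/eqP; rewrite eq_le bg // ag.
Qed.

(** The infimum exists in the extended line: it is [+oo], [-oo] or an element of [R]. Allowing all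
    three makes the property stable under finite unions. *)
Definition glb_complete (A : R -> Prop) : Prop :=
  (forall x, ~ A x) \/ (forall b, exists2 x, A x & x < b) \/ exists a, is_glb A a.

Lemma glb_complete_or (A B : R -> Prop) :
  glb_complete A -> glb_complete B -> glb_complete (fun x => A x \/ B x).
Proof.
move=> [A0|cA].
  by have -> : (fun x => A x \/ B x) = B
    by apply/funext => x; apply/propext; have := A0 x; tauto.
move=> [B0|cB].
  have -> : (fun x => A x \/ B x) = A
    by apply/funext => x; apply/propext; have := B0 x; tauto.
  by right.
right; case: cA => [uA|[a [al ag]]].
  by left=> b; have [x Ax xb] := uA b; exists x; [left|].
case: cB => [uB|[b [bl bg]]].
  by left=> c; have [x Bx xc] := uB c; exists x; [right|].
right; exists (Num.min a b); split=> [x [/al|/bl] h|c h].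
- by rewrite ge_min h.
- by rewrite ge_min h orbT.
by rewrite le_min ag ?bg // => x ?; apply: h; [right|left].
Qed.

Lemma glb_complete_itv (a b : \bar R) : glb_complete (fun x => (a < x%:E < b)%E).
Proof.
have [[z /andP[az zb]]|E] := pselect (exists z : R, (a < z%:E < b)%E); last first.
  by left=> x abx; apply: E; exists x.
right; case: a az => [a| |] //= az; last first.
  left=> c; exists (Num.min z (c - 1)); last first.
    by rewrite gt_min ltrBlDr ltrDl ltr01 orbT.
  rewrite ltNyr /=; apply: le_lt_trans zb.
  by rewrite lee_fin ge_min lexx.
rewrite lte_fin in az.
right; exists a; split=> [x /andP[]|c h]; first by rewrite lte_fin => /ltW.
rewrite leNgt; apply/negP => ac.
(* If a lower bound [c] exceeded [a], the midpoint of [a] and [m] would be a point of the interval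
   below [c]. *)
pose m := Num.min z c.
have am : a < m by rewrite lt_min az.
have := h ((a + m) / 2); rewrite lte_fin midf_lt //= => /(_ _) h'.
have mm : (a + m) / 2 < m by rewrite midf_lt.
have : c <= (a + m) / 2.
  apply: h'; apply: le_lt_trans zb.
  by rewrite lee_fin (le_trans (ltW mm)) // ge_min lexx.
by rewrite leNgt (lt_le_trans mm) // ge_min lexx orbT.
Qed.

(** By o-minimality [A] is a finite union of points and intervals, each of which has an infimum in
    the extended line; the last two hypotheses exclude infinite values. *)
Lemma glb_exists (A : R -> Prop) : Dset (fun x : 'rV_1 => A (x 0 0)) ->
  (exists x, A x) -> (exists b, forall x, A x -> b <= x) -> exists a, is_glb A a.
Proof.
move=> /definable_ominimal [pts [itvs E]] [x0 Ax0] [b Ab].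
suff : glb_complete A.
  by move=> [/(_ _ Ax0)|[/(_ b) [x /Ab h /(le_lt_trans h)]|]] //; rewrite ltxx.
have {E} -> : A = fun x => x \in pts \/ exists2 ab, ab \in itvs & (ab.1 < x%:E < ab.2)%E.
  apply/funext => x; have := congr1 (fun D => D (const_mx x)) E.
  by rewrite /= !mxE.
apply: glb_complete_or.
  elim: pts => [|p pts IH]; first by left.
  have -> : (fun x => is_true (x \in p :: pts)) = (fun x => x = p \/ x \in pts).
    by apply/funext => x; apply/propext; rewrite inE; split=> [/predU1P|/predU1P].
  apply: glb_complete_or => //; right; right; exists p.
  by split=> [_ -> //|c]; apply.
elim: itvs => [|ab itvs IH]; first by left=> x [].
have -> : (fun x => exists2 cd, cd \in ab :: itvs & (cd.1 < x%:E < cd.2)%E) =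
  (fun x => (ab.1 < x%:E < ab.2)%E \/ exists2 cd, cd \in itvs & (cd.1 < x%:E < cd.2)%E).
  apply/funext => x; apply/propext; split=> [[cd]|[h|[cd h1 h2]]].
  - by rewrite inE => /predU1P[->|]; [left|right; exists cd].
  - by exists ab; rewrite ?mem_head.
  - by exists cd; rewrite ?inE ?h1 ?orbT.
exact: glb_complete_or (glb_complete_itv _ _) IH.
Qed.

(** Being the infimum of [E x] is a first-order condition with exactly one solution, so it defines
    the graph of a definable function. *)
Lemma glb_fun n (E : 'rV[R]_n -> R -> Prop) :
  Dset (fun z : 'rV[R]_(n + 1) => E (lsubmx z) (rsubmx z 0 0)) ->
  (forall x, exists t, E x t) -> (forall x, exists b, forall t, E x t -> b <= t) ->
  exists2 f, Dfun f & forall x, is_glb (E x) (f x).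
Proof.
move=> dE E0 Eb.
have glbE x : exists a, is_glb (E x) a.
  apply: glb_exists => //.
  by definable.
have [f fE] := choice glbE; exists f => //.
apply: (Dfun_graph (G := fun x a => is_glb (E x) a)).
  by move=> x t; split=> [h|-> //]; apply: is_glb_unique (fE x).
by rewrite /is_glb; definable.
Qed.

Ltac definable_ext ::=
  first [apply: Dfun_norm | apply: Dfun_min | apply: Dfun_inv
        | apply: Dfun_if].

(** * Cluster points, distance functions and inf-convolution *)

Definition close n (x y : 'rV[R]_n) (e : R) : Prop :=
  forall i, `|x 0 i - y 0 i| < e.

Definition adherent n (X : 'rV[R]_n -> Prop) (x : 'rV[R]_n) : Prop :=
  forall e : R, 0 < e -> exists y, X y /\ close y x e.

(** Definable Bolzano-Weierstrass: the sets [D _ e], nonempty, uniformly bounded and shrinking with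
    [e], take the place of a bounded sequence. *)
Lemma definable_cluster_point n (D : 'rV[R]_n -> R -> Prop) (M : R) :
  Dset (fun z : 'rV[R]_(n + 1) => D (lsubmx z) (rsubmx z 0 0)) ->
  (forall x (e e' : R), D x e -> e <= e' -> D x e') ->
  (forall e : R, 0 < e -> exists x, D x e) ->
  (forall x e, D x e -> forall i, `|x 0 i| <= M) ->
  exists a, forall e : R, 0 < e -> exists x, D x e /\ close x a e.
Proof.
move=> dD Dmono D0 DM.
(* The coordinates of a are found one after the other, each as an infimum. *)
suff /(_ n) [a Ha] : forall k, exists a : 'rV[R]_n, forall e : R, 0 < e ->
    exists x, D x e /\ forall i : 'I_n, (i < k)%N -> `|x 0 i - a 0 i| < e.
  by exists a => e /Ha [x [Dx xa]]; exists x; split=> // i; apply: xa.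
elim=> [|k [a IH]]; first by exists 0 => e /D0 [x Dx]; exists x.
have [nk|kn] := leqP n k.
  exists a => e /IH [x [Dx xa]]; exists x; split=> // i _.
  by apply: xa; apply: leq_trans nk.
pose k0 := Ordinal kn.
(* The infimum of [T] is the lower limit of coordinate [k0] along points of [D] whose earlier
   coordinates tend to those of [a]. *)
pose T t := forall e : R, 0 < e -> exists x, D x e /\
  (forall i : 'I_n, (i < k)%N -> `|x 0 i - a 0 i| < e) /\ x 0 k0 <= t.
have [c [cl cg]] : exists c, is_glb T c.
  apply: glb_exists; first by rewrite /T; definable.
    exists M => e /IH [x [Dx xa]]; exists x; split=> //; split=> //.
    by apply: le_trans (DM _ _ Dx k0); apply: ler_norm.
  exists (- M) => t /(_ 1 ltr01) [x [Dx [_ xt]]]; apply: le_trans xt.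
  by have := DM _ _ Dx k0; rewrite ler_norml => /andP[].
exists (\row_i if i == k0 then c else a 0 i) => e e0.
have [t Tt tc] : exists2 t, T t & t < c + e.
  apply: contrapT => H; suff : c + e <= c by rewrite gerDl leNgt e0.
  by apply: cg => t Tt; rewrite leNgt; apply/negP => tc; apply: H; exists t.
(* Since [c - e] is below the infimum it is not in [T], so some scale [e1] forces coordinate [k0]
   above [c - e]. The bound from above comes from [t] in [T], applied at scale [min e e1]. *)
have [e1 [e1_gt0 He1]] : exists e1 : R, 0 < e1 /\ forall x, D x e1 ->
    (forall i : 'I_n, (i < k)%N -> `|x 0 i - a 0 i| < e1) -> c - e < x 0 k0.
  apply: contrapT => H; suff /cl : T (c - e) by rewrite lerDl oppr_ge0 leNgt e0.
  move=> e1 e1_gt0; apply: contrapT => H1; apply: H; exists e1; split=> // x Dx xa.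
  by rewrite ltNge; apply/negP => xc; apply: H1; exists x.
have m0 : 0 < Num.min e e1 by rewrite lt_min e0.
have [x [Dx [xa xt]]] := Tt _ m0.
have me : Num.min e e1 <= e by rewrite ge_min lexx.
have me1 : Num.min e e1 <= e1 by rewrite ge_min lexx orbT.
exists x; split; first exact: Dmono me.
move=> i; rewrite ltnS mxE; case: eqP => [->|ik] ik'; last first.
  apply: lt_le_trans me; apply: xa; rewrite ltn_neqAle ik' andbT.
  by apply: contra_notN ik => /eqP ik; apply/val_inj.
have cx : c - e < x 0 k0.
  by apply: He1 (Dmono _ _ _ Dx me1) _ => j /xa /lt_le_trans; apply.
by rewrite ltr_norml; apply/andP; split; lra.
Qed.

Lemma distance_fun n (B : 'rV[R]_n -> Prop) : Dset B ->
  exists d : 'rV[R]_n -> R,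
    [/\ Dfun d, forall x : 'rV[R]_n, 0 <= d x <= 1,
        forall (x y : 'rV[R]_n) (e : R), 0 <= e ->
          (forall i, `|x 0 i - y 0 i| <= e) -> d x <= d y + e,
        forall (x y : 'rV[R]_n) (e : R), 0 <= e ->
          (forall i, `|x 0 i - y 0 i| <= e) -> B y -> d x <= e &
        forall (x : 'rV[R]_n) (e : R), 0 < e -> (forall y, B y -> ~ close y x e) -> 0 < d x].
Proof.
move=> dB.
(* The disjunct [1 <= t] truncates the distance and keeps the family nonempty when [B] is empty;
   [0 <= t] matters for [n = 0], where the condition on coordinates is vacuous. *)
pose E (x : 'rV[R]_n) (t : R) := 1 <= t \/
  (0 <= t /\ exists y : 'rV[R]_n, B y /\ forall i, `|x 0 i - y 0 i| <= t).
have E_ge0 x t : E x t -> 0 <= t by case=> [/(le_trans ler01)|[]].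
have E1 x : E x 1 by left.
have [|||d dd dE] := @glb_fun n E; first by rewrite /E; definable.
- by move=> x; exists 1.
- by move=> x; exists 0 => t; apply: E_ge0.
exists d; split=> //.
- move=> x; have [dl dg] := dE x.
  by rewrite dl //= dg // => t; apply: E_ge0.
- move=> x y e e0 xy; have [xl xg] := dE x; have [yl yg] := dE y.
  rewrite -lerBlDr; apply: yg => t [t1|[t0 [z [Bz yz]]]]; rewrite lerBlDr; apply: xl.
    by left; rewrite (le_trans t1) ?lerDl.
  right; split; first exact: addr_ge0.
  exists z; split=> // i; apply: le_trans (ler_distD (y 0 i) _ _) _.
  by rewrite addrC lerD.
- move=> x y e e0 xy By; have [xl xg] := dE x; apply: xl; right; split=> //.
  by exists y.
- move=> x e e0 xB; have [xl xg] := dE x.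
  apply: (@lt_le_trans _ _ (Num.min e 1)); first by rewrite lt_min e0 ltr01.
  apply: xg => t; rewrite ge_min => -[->|[t0 [y [By xy]]]]; first by rewrite orbT.
  rewrite leNgt; case: ltP => //= te; case: (xB _ By) => i.
  by rewrite distrC; apply: le_lt_trans te.
Qed.

(* [E] below is an upward closed version of the set of the inf-convolution. *)
Lemma minorant n (X : 'rV[R]_n -> Prop) (f w : 'rV[R]_n -> R) :
  Dset X -> Dfun f -> Dfun w -> (forall x, X x -> 0 <= f x) ->
  exists nu : R -> R,
    [/\ Dfun (fun x : 'rV[R]_1 => nu (x 0 0)),
        forall s : R, 0 <= s -> 0 <= nu s <= s,
        forall s t e : R, 0 <= e -> s <= t + e -> nu s <= nu t + e,
        forall x, X x -> nu (w x) <= f x &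
        forall s : R, 0 < s -> nu s <= 0 -> forall e : R, 0 < e ->
          exists x, [/\ X x, f x < e & s - e < w x]].
Proof.
move=> dX df dw f_ge0.
pose E (s : 'rV[R]_1) v := (0 <= v /\ s 0 0 <= v) \/
  (exists x : 'rV[R]_n, X x /\ (f x <= v /\ f x + s 0 0 - w x <= v)).
have E_ge0 s v : E s v -> 0 <= v.
  by case=> [[]|[x [/f_ge0 fx [/(le_trans fx)]]]].
have [|||nu dnu nuE] := @glb_fun 1 E; first by rewrite /E; definable.
- move=> s; exists (Num.max 0 (s 0 0)); left.
  by rewrite !le_max !lexx orbT.
- by move=> s; exists 0 => t; apply: E_ge0.
exists (fun s => nu s%:M).
have sE (s : R) : (s%:M : 'rV[R]_1) 0 0 = s by rewrite mxE.
split.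
- by apply: Dset_ext dnu => z; rewrite -mx11_scalar.
- move=> s s0; have [l g] := nuE s%:M; rewrite l; last by left; rewrite sE.
  by rewrite g // => t; apply: E_ge0.
- move=> s t e e0 st; have [sl sg] := nuE s%:M; have [tl tg] := nuE t%:M.
  rewrite -lerBlDr; apply: tg => v; rewrite /E !sE lerBlDr => H; apply: sl; rewrite /E !sE.
  case: H => [[v0 vt]|[x [Xx [fv fv']]]]; first by left; split; lra.
  by right; exists x; split=> //; split; lra.
- move=> x Xx; have [l g] := nuE (w x)%:M; apply: l; right; exists x.
  by split=> //; split=> //; rewrite sE; lra.
- move=> s s0 nus e e0; have [l g] := nuE s%:M.
  (* A value [v < s] rules out the first disjunct of [E], so it comes from a point of [X]; then
     [v < e] gives both required bounds, using [0 <= f x]. *)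
  pose m := Num.min e s.
  have m0 : 0 < m by rewrite lt_min e0.
  have [v Ev vm] : exists2 v, E s%:M v & v < m.
    apply: contrapT => H; suff : m <= 0 by rewrite leNgt m0.
    apply: le_trans nus; apply: g => v Ev.
    by rewrite leNgt; apply/negP => vm; apply: H; exists v.
  move: vm; rewrite lt_min => /andP[ve vs].
  case: Ev; rewrite sE; first by case=> _; lra.
  move=> [x [Xx [fv fv']]]; exists x; have := f_ge0 x Xx; split=> //; lra.
Qed.

(** * Continuity *)

Lemma ball_close n (x y : 'rV[R]_n) (e : R) : 0 < e -> ball x e y <-> close y x e.
Proof.
move=> e0; split=> [[_ xy] i|xy]; first by rewrite distrC; apply: xy.
by split=> // i j; rewrite ord1 /ball /= distrC; apply: xy.
Qed.

Lemma within_continuous_close n (X : set 'rV[R]_n) (f : 'rV[R]_n -> R) x (e : R) :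
  {within X, continuous f} -> X x -> 0 < e ->
  exists2 d : R, 0 < d & forall y, X y -> close y x d -> `|f y - f x| < e.
Proof.
move=> /subspace_continuousP cf Xx e0.
have /cvgrPdist_lt /(_ _ e0) := cf x Xx.
rewrite near_withinE => /nbhs_ballP [d d0 H]; exists d => // y Xy yx.
by rewrite distrC; apply: H Xy; apply/ball_close.
Qed.

Lemma lipschitz_continuous (M : pseudoMetricType R) (f : M -> R) :
  (forall x y (e : R), 0 < e -> ball x e y -> f x <= f y + e) -> continuous f.
Proof.
move=> lf x; apply/cvgrPdist_le => e e0; apply/nbhs_ballP; exists e => // y xy.
have h1 := lf x y e e0 xy; have h2 := lf y x e e0 (ball_sym xy).
by rewrite ler_norml; apply/andP; split; lra.
Qed.

Lemma Dfun_extend n (X : set 'rV[R]_n) (f : 'rV[R]_n -> R) :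
  definable_fun S X f -> Dfun (fun x => if pselect (X x) then f x else 0).
Proof.
case=> dX df; have {}dX : Dset X by [].
apply: (Dfun_graph (G := fun x t => (X x /\ t = f x) \/ (~ X x /\ t = 0))).
  by move=> x t; case: pselect => Xx; split=> [[[]|[]]|]; [| |left| | |right].
by apply: Dset_or; [exact: df | definable].
Qed.

Lemma Dfun_restrict n (X : 'rV[R]_n -> Prop) (f : 'rV[R]_n -> R) :
  Dset X -> Dfun f -> definable_fun S X f.
Proof.
move=> dX df; split=> //.
suff : Dset (fun z : 'rV[R]_(n + 1) => X (lsubmx z) /\ rsubmx z 0 0 = f (lsubmx z)) by [].
by definable.
Qed.

(* Of the form t / (1 + |t|), rather than t / (1 + t), to be continuous on all of R. *)
Definition squash (t : R) : R := t / (1 + `|t|).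

Lemma squash_continuous : continuous squash.
Proof.
move=> t; apply: cvgM; first exact: cvg_id.
apply: cvgV; first by rewrite gt_eqF // ltr_pwDl.
by apply: cvgD; [exact: cvg_cst | exact: norm_continuous].
Qed.

Lemma squash_bounds (t : R) : 0 <= t -> 0 <= squash t <= 1 /\ squash t <= t.
Proof.
move=> t0; rewrite /squash ger0_norm //.
have t1 : 0 < 1 + t by rewrite ltr_pwDl.
have -> : 0 <= t / (1 + t) by rewrite divr_ge0 // ltW.
split; rewrite /= ler_pdivrMr //; first by lra.
by rewrite mulrDr mulr1 lerDl mulr_ge0.
Qed.

Lemma squash_lt (s t : R) : 0 <= s -> s < t -> squash s < squash t.
Proof.
move=> s0 st; have t0 : 0 <= t by apply: le_trans (ltW st).
rewrite /squash !ger0_norm // ltr_pdivrMr ?ltr_pwDl // mulrAC ltr_pdivlMr ?ltr_pwDl //.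
by rewrite !mulrDr !mulr1 [t * s]mulrC ltrD2r.
Qed.

Lemma Dfun_squash n (f : 'rV[R]_n -> R) : Dfun f -> Dfun (fun x => squash (f x)).
Proof. by move=> df; rewrite /squash; definable. Qed.

(** * Comparison functions *)

(** Dividing the distance to the frontier by a function growing at infinity makes [h] small near
    both; a lower bound on [h] thus keeps points bounded and away from the frontier. *)
Lemma exhaustion n (X : set 'rV[R]_n) : Dset X -> locally_closed X ->
  exists h : 'rV[R]_n -> R,
    [/\ Dfun h, continuous h, forall x, X x -> 0 < h x, forall x, 0 <= h x <= 1 &
        forall s : R, 0 < s ->
          (forall x, s <= h x -> forall i, `|x 0 i| <= s^-1) /\
          (forall a, adherent (fun x => X x /\ s <= h x) a -> X a)].
Proof.
move=> dX [U [F [oU cF XUF]]].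
pose B y := ~ X y /\ adherent X y.
have dB : Dset B by rewrite /B /adherent /close; definable.
have [d [dd d01 dlip dB0 dpos]] := distance_fun dB.
pose N (x : 'rV[R]_n) := 1 + \sum_i x 0 i * x 0 i.
have N1 x : 1 <= N x by rewrite lerDl; apply: sumr_ge0 => i _; rewrite -expr2 sqr_ge0.
have N0 x : 0 < N x by apply: lt_le_trans (N1 x).
have hd x : d x / N x <= d x.
  by have /andP[? _] := d01 x; rewrite ler_pdivrMr // ler_peMr.
exists (fun x => d x / N x); split.
- by rewrite /N; definable.
- move=> x; apply: (continuousM (s := d) (t := fun y => (N y)^-1)).
    suff dc : continuous d by exact: dc.
    apply: lipschitz_continuous => y z e e0 [_ yz].
    by apply: dlip (ltW e0) _ => i; apply/ltW/yz.
  apply: continuousV; first by rewrite gt_eqF.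
  apply: (continuousD (V := R^o) (f := fun=> 1) (g := fun y : 'rV[R]_n => \sum_i y 0 i * y 0 i));
    first exact: cst_continuous.
  suff sc : continuous (fun y : 'rV[R]_n => \sum_i y 0 i * y 0 i) by exact: sc.
  apply: continuous_big => [|i _ y]; first exact: add_continuous.
  by apply: continuousM; apply: coord_continuous.
- move=> x Xx; apply: divr_gt0 => //.
  have : nbhs x U by apply: open_nbhs_nbhs; split=> //; move: Xx; rewrite XUF => -[].
  (* A ball around [x] inside [U] misses [B]: a point of it adherent to [X] lies in the closed set
     [F], hence in [X]. *)
  move=> /nbhs_ballP [e /= e0 eU]; apply: (dpos x e e0) => y [nXy Xy] yx; apply: nXy.
  rewrite XUF; split; first by apply: eU; apply/ball_close.
  apply: cF => V /nbhs_ballP [e' /= e'0 e'V]; have [z [Xz zy]] := Xy _ e'0.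
  exists z; split; first by move: Xz; rewrite XUF => -[].
  by apply: e'V; apply/ball_close.
- move=> x; have /andP[d0 d1] := d01 x; apply/andP; split.
    by rewrite divr_ge0 // ltW.
  exact: le_trans (hd x) d1.
- move=> s s0; split.
    move=> x; rewrite ler_pdivlMr // => sN i.
    have {}sN : N x <= s^-1.
      rewrite -[leRHS]mul1r ler_pdivlMr // mulrC; apply: le_trans sN _.
      by have /andP[] := d01 x.
    apply: le_trans sN; rewrite /N (bigD1 i) //=.
    have : 0 <= \sum_(j < n | j != i) x 0 j * x 0 j.
      by apply: sumr_ge0 => j _; rewrite -expr2 sqr_ge0.
    have -> : x 0 i * x 0 i = `|x 0 i| * `|x 0 i|.
      by rewrite -normrM ger0_norm // -expr2 sqr_ge0.
    (* Gives [2 * v <= 1 + v * v], hence [v <= N x]. *)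
    have := sqr_ge0 (`|x 0 i| - 1); have := normr_ge0 (x 0 i).
    by rewrite expr2; set v := `|x 0 i|; set w := \sum_(_ < _ | _) _; nra.
  move=> a aX; apply: contrapT => nXa.
  have Ba : B a.
    by split=> // e /aX [x [[Xx _] xa]]; exists x.
  (* A point of [X] within [s / 2] of [a] in [B] has [h x <= d x <= s / 2], against [s <= h x]. *)
  have s2 : 0 < s / 2 by rewrite divr_gt0.
  have [x [[Xx sx] xa]] := aX _ s2.
  have : d x <= s / 2 by apply: (dB0 x a) (ltW s2) _ Ba => i; apply/ltW/xa.
  have := hd x; lra.
Qed.

Lemma joint_minorant n (X : set 'rV[R]_n) (f1 f2 : 'rV[R]_n -> R) :
  Dset X -> locally_closed X -> Dfun f1 -> Dfun f2 ->
  {within X, continuous f1} -> {within X, continuous f2} ->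
  (forall x, X x -> 0 <= f1 x) -> (forall x, X x -> 0 <= f2 x) ->
  (forall x, X x -> f2 x = 0 -> f1 x = 0) ->
  exists (nu : R -> R) (h : 'rV[R]_n -> R),
    [/\ Dfun (fun x : 'rV[R]_1 => nu (x 0 0)), continuous nu,
        forall s, 0 <= s -> 0 <= nu s <= s, forall s, 0 < s -> 0 < nu s &
        {homo nu : s t / s <= t}] /\
    [/\ Dfun h, continuous h, forall x, X x -> 0 < h x, forall x, 0 <= h x <= 1 &
        forall x, X x -> nu (Num.min (h x) (squash (f1 x))) <= f2 x].
Proof.
move=> dX lcX df1 df2 cf1 cf2 f1_ge0 f2_ge0 f21.
have [h [dh ch h_gt0 h01 hs]] := exhaustion dX lcX.
pose w x := Num.min (h x) (squash (f1 x)).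
have dw : Dfun w by rewrite /w /squash; definable.
have [nu [dnu nu_bounds nuD nuw nu_le0]] := minorant dX df2 dw f2_ge0.
exists nu, h; split; split=> //.
- by apply: lipschitz_continuous => x y e e0; rewrite /ball /= ltr_norml => /andP[_ xy];
    apply: nuD (ltW e0) _; lra.
- move=> s s0; rewrite ltNge; apply/negP => /(nu_le0 s s0) nus.
  have s2 : 0 < s / 2 by rewrite divr_gt0.
  have [hb hc] := hs _ s2.
  (* If [nu s <= 0], points with [f2] arbitrarily small and [w > s - s / 2] exist; the bound on [h]
     makes them cluster at a point of [X]. *)
  pose D x e := X x /\ f2 x < e /\ s / 2 <= h x /\ s / 2 <= squash (f1 x).
  have [|||| a Ha] := @definable_cluster_point n D (s / 2)^-1.
  + by rewrite /D /squash; definable.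
  + by move=> x e e' [Xx [fe [? ?]]] ee'; split=> //; split=> //; apply: lt_le_trans ee'.
  + move=> e e0; have [|x [Xx fx]] := nus (Num.min e (s / 2)); first by rewrite lt_min e0.
    have me : Num.min e (s / 2) <= e by rewrite ge_min lexx.
    have me' : Num.min e (s / 2) <= s / 2 by rewrite ge_min lexx orbT.
    rewrite lt_min => /andP[sh sq]; exists x; split=> //; split; last by split; lra.
    exact: lt_le_trans me.
  + by move=> x e [_ [_ [shx _]]] i; apply: hb.
  have Xa : X a.
    by apply: hc => e /Ha [x [[Xx [_ [shx _]]] xa]]; exists x.
  (* Otherwise continuity keeps [f2] above [f2 a / 2] near [a], while [D] provides nearby points
     with smaller values. *)
  have f2a : f2 a = 0.
    apply/eqP; rewrite eq_le f2_ge0 // andbT leNgt; apply/negP => f2a.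
    have f2a2 : 0 < f2 a / 2 by rewrite divr_gt0.
    have [e e0 He] := within_continuous_close cf2 Xa f2a2.
    have [|x [[Xx [f2x _]] xa]] := Ha (Num.min e (f2 a / 2)); first by rewrite lt_min e0.
    have xa' : close x a e.
      by move=> i; apply: lt_le_trans (xa i) _; rewrite ge_min lexx.
    have := He x Xx xa'; rewrite ltr_norml => /andP[+ _].
    by move: f2x; rewrite lt_min => /andP[_]; lra.
  have f1a := f21 _ Xa f2a.
  (* Near [a] continuity gives [f1 x < s / 2], whereas [D] requires
     [s / 2 <= squash (f1 x) <= f1 x]. *)
  have [e e0 He] := within_continuous_close cf1 Xa s2.
  have [x [[Xx [_ [_ sx]]] xa]] := Ha e e0.
  have [_ sq] := squash_bounds (f1_ge0 x Xx).
  by have := He x Xx xa; rewrite f1a subr0 ger0_norm ?f1_ge0 //; lra.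
- by move=> s t st; have := nuD s t 0 (lexx 0); rewrite !addr0; apply.
Qed.

End Definability.

(** * Construction of [rho] and [c] *)

Theorem proposition3p5 (R : rcfType) (S : ominimal_structure R) (n : nat)
    (X : set 'rV[R]_n) (phi1 phi2 : 'rV[R]_n -> R)
    (X_lc : locally_closed X) (X_def : definable S X)
    (phi1_ge0 : forall x, X x -> 0 <= phi1 x)
    (phi2_ge0 : forall x, X x -> 0 <= phi2 x)
    (phi1_cont : {within X, continuous phi1})
    (phi2_cont : {within X, continuous phi2})
    (phi1_def : definable_fun S X phi1)
    (phi2_def : definable_fun S X phi2)
    (zeros : X `&` phi2 @^-1` [set 0] `<=` X `&` phi1 @^-1` [set 0]) :
  exists (rho : R -> R) (c : 'rV[R]_n -> R),
    [/\ (forall t, nonneg_ray R t -> nonneg_ray R (rho t)),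
        (forall s t, nonneg_ray R s -> nonneg_ray R t -> s < t -> rho s < rho t),
        {within nonneg_ray R, continuous rho} &
        definable_fun S [set t : 'rV[R]_1 | nonneg_ray R (t 0 0)]
          (fun t => rho (t 0 0))] /\
    [/\ (forall x, X x -> 0 < c x),
        {within X, continuous c},
        definable_fun S X c,
        (forall x, X x -> phi2 x = 0 -> c x = 1) &
        (forall x, X x -> phi2 x >= c x * rho (phi1 x))].
Proof.
pose ext (phi : 'rV[R]_n -> R) x := if pselect (X x) then phi x else 0.
have extE phi x : X x -> ext phi x = phi x by rewrite /ext; case: pselect.
have ext_cont phi : {within X, continuous phi} -> {within X, continuous (ext phi)}.
  by apply: subspace_eq_continuous => x; rewrite inE => Xx; exact/esym/extE.
have d1 : Dfun S (ext phi1) := Dfun_extend phi1_def.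
have d2 : Dfun S (ext phi2) := Dfun_extend phi2_def.
have [|||nu [h [[dnu cnu nu_bounds nu_gt0 nu_homo] [dh ch h_gt0 h01 nuw]]]] :=
  joint_minorant X_def X_lc d1 d2 (ext_cont _ phi1_cont) (ext_cont _ phi2_cont).
- by move=> x Xx; rewrite extE // phi1_ge0.
- by move=> x Xx; rewrite extE // phi2_ge0.
- by move=> x Xx; rewrite !extE // => f20; have [] := zeros x (conj Xx f20).
pose q t := nu (squash t) * squash t.
have q_ge0 t : 0 <= t -> 0 <= q t.
  move=> /squash_bounds [/andP[t0 _] _]; have /andP[nt _] := nu_bounds _ t0.
  exact: mulr_ge0.
have q_lt s t : 0 <= s -> s < t -> q s < q t.
  move=> s0 st; have qst := squash_lt s0 st.
  have [/andP[qs0 _] _] := squash_bounds s0.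
  (* [nu] is only known to be nondecreasing; strictness comes from the factor [squash], as
     [nu (squash t)] is positive. *)
  apply: le_lt_trans (_ : nu (squash t) * squash s < _).
    by rewrite ler_wpM2r // nu_homo // ltW.
  by rewrite ltr_pM2l // nu_gt0 // (le_lt_trans qs0).
have q_cont : continuous q.
  have sq := @squash_continuous R.
  move=> t; apply: continuousM; last exact: sq.
  by apply: continuous_comp; [exact: sq | exact: cnu].
pose c x := nu (h x) / (nu (h x) + q (ext phi1 x)).
have nuh_gt0 x : X x -> 0 < nu (h x) by move=> /h_gt0 /nu_gt0.
have e1_ge0 x : X x -> 0 <= ext phi1 x by move=> Xx; rewrite extE // phi1_ge0.
have den_gt0 x : X x -> 0 < nu (h x) + q (ext phi1 x).
  by move=> Xx; rewrite ltr_wpDr ?nuh_gt0 // q_ge0 // e1_ge0.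
have dq : Dfun S (fun t : 'rV[R]_1 => q (t 0 0)).
  have dsq := Dfun_squash (Dfun_coord S (ord0 : 'I_1)).
  apply: Dfun_mul => //.
  exact: Dfun_comp1 dnu dsq.
exists (fun t => q t * q t), c; split; split.

- by move=> t t0; apply: mulr_ge0; apply: q_ge0.
- move=> s t s0 t0 st; have qs := q_ge0 _ s0; have := q_lt s t s0 st; nra.
- by apply: continuous_subspaceT => t; apply: continuousM; apply: q_cont.
- apply: (@Dfun_restrict R S 1 (fun t => nonneg_ray R (t 0 0))).
    exact: Dset_le (Dfun_const S 1 0) (Dfun_coord S (ord0 : 'I_1)).
  exact: Dfun_mul.
- by move=> x Xx; rewrite divr_gt0 ?nuh_gt0 ?den_gt0.
- apply/subspace_continuousP => x Xx.
  (* Limits are taken along [within X], because [ext phi1] is continuous only relative to [X]. *)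
  have nuh_cvg : nu (h y) @[y --> within X (nbhs x)] --> nu (h x).
    apply: (@cvg_comp _ _ _ h nu _ _ _ _ (cnu (h x))).
    exact: cvg_within_filter (ch x).
  have q_cvg : q (ext phi1 y) @[y --> within X (nbhs x)] --> q (ext phi1 x).
    apply: (@cvg_comp _ _ _ (ext phi1) q _ _ _ _ (q_cont (ext phi1 x))).
    by have /subspace_continuousP := ext_cont _ phi1_cont; apply.
  apply: cvgM => //; apply: cvgV; first by rewrite gt_eqF // den_gt0.
  exact: cvgD.
- apply: Dfun_restrict => //.
  have dnuh : Dfun S (fun x => nu (h x)) := Dfun_comp1 dnu dh.
  have dq1 : Dfun S (fun x => q (ext phi1 x)) := Dfun_comp1 dq d1.
  exact: Dfun_mul dnuh (Dfun_inv (Dfun_add dnuh dq1)).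
- move=> x Xx f20; have [_ f10] := zeros x (conj Xx f20).
  rewrite /c extE // f10 /q /squash mul0r mulr0 addr0 divff //.
  by rewrite gt_eqF // nuh_gt0.
- move=> x Xx; rewrite -(extE phi2 x Xx) -(extE phi1 x Xx).
  apply: le_trans (nuw x Xx); set t := ext phi1 x.
  have t0 : 0 <= t by apply: e1_ge0.
  have [/andP[s0 s1] _] := squash_bounds t0.
  have /andP[hx0 hx1] := h01 x.
  have /andP[a0 a1] := nu_bounds _ hx0; have /andP[b0 b1] := nu_bounds _ s0.
  have qt0 := q_ge0 _ t0; have den0 := den_gt0 _ Xx; have nuh0 := nuh_gt0 _ Xx.
  (* The second factor [q t] of [rho] absorbs the denominator of [c], since
     [q t / (nu (h x) + q t) <= 1]. *)
  apply: (@le_trans _ _ (nu (h x) * q t)).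
    rewrite /c -/t mulrA -mulrA mulrAC ler_pdivrMr //.
    have : 0 <= nu (h x) * q t by rewrite mulr_ge0 // ltW.
    nra.
  (* With all factors at most 1, [nu (h x) * q t] is below both [nu (h x)] and [nu (squash t)], one
     of which is [nu] of the minimum. *)
  have qnu : q t <= nu (squash t) by rewrite /q ler_piMr.
  have q1 : q t <= 1 by apply: le_trans qnu _; apply: le_trans s1.
  have : nu (h x) * q t <= nu (h x) by rewrite ler_piMr.
  have : nu (h x) * q t <= nu (squash t).
    apply: le_trans qnu; rewrite ler_piMl //; exact: le_trans hx1.
  by case: (leP (h x) (squash t)).
Qed.
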